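(* Let $N,k$ be integers with $N\geq 3$ and $k\geq 1$. Let $T_0,T_m,T_m^*$ ($m\geq 1$) be the $4$-charts described in the context, let $F(\Gamma)$ denote the surface-link of a chart $\Gamma$, and let $Q_N$, $Q_{k+2}$ be the quandles described in the context. Then: (a) $|\mathrm{Col}_{Q_N}(F(T_0))|=(N-1)^2+1$. (b) $|\mathrm{Col}_{Q_N}(F(T_{2k}))|=N$ and $|\mathrm{Col}_{Q_N}(F(T_{2k}^* ))|=N$. (c) $|\mathrm{Col}_{Q_{k+2}}(F(T_{2k-1}))|=(k+2)^2$ and $|\mathrm{Col}_{Q_{k+2}}(F(T_{2k-1}^* ))|=(k+2)^2$. (d) For every integer $\ell$ with $1\leq \ell<k$, $|\mathrm{Col}_{Q_{k+2}}(F(T_{2\ell-1}))|=(k+1)^2+1$ and $|\mathrm{Col}_{Q_{k+2}}(F(T_{2\ell-1}^* ))|=(k+1)^2+1$.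
   Context: **Quandles.** A quandle is a set $Q$ with a binary operation $*$ such that $a*a=a$; for all $a,b$ there is a unique $x$ with $x*a=b$ (written $x=b\,\overline{*}\,a$); and $(a*b)*c=(a*c)*(b*c)$. For $N\geq 3$, $Q_N=\{1,\dots,N\}$ with $x*y=x$ if $y\neq N$; $x*N=x+1$ if $1\le x\leq N-2$; $(N-1)*N=1$; $N*N=N$. **Colorings.** A surface-link is a closed surface locally flatly embedded in $\mathbb{R}^4$ (here always oriented). A surface diagram of $F$ is a generic projection of $F$ to $\mathbb{R}^3$, with the under-sheet broken along double curves; the connected pieces are broken sheets. Normals are chosen so that (tangents, normal) matches the orientation of $\mathbb{R}^3$. A coloring of the diagram by $Q$ is a map $\mathcal C$ from the broken sheets to $Q$ such that at each double point with over-sheet $R_j$ and under-sheets $R_i,R_k$, the normal of $R_j$ pointing from $R_i$ to $R_k$, one has $\mathcal C(R_i)*\mathcal C(R_j)=\mathcal C(R_k)$. $\mathrm{Col}_Q(F)$ is the set of colorings; $|\mathrm{Col}_Q(F)|$ is independent of the diagram. The knot quandle $Q(F)$ is the quandle generated by the broken sheets with relations $R_i*R_j=R_k$ at double points, so $\mathrm{Col}_Q(F)$ is identified with $\mathrm{Hom}(Q(F),Q)$. **Surface braids and charts.** A simple surface braid of degree $n$ is an oriented surface $S$ properly, locally flatly embedded in $D_1\times D_2$ ($D_i$ disks) such that $S\to D_2$ is a simple branched cover of degree $n$ (all fibres have $n-1$ or $n$ points) and $\partial S=X_n\times\partial D_2$, $X_n$ being $n$ fixed interior points of $D_1$. Its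 closure is the surface-link obtained by adding $X_n\times \overline{D}_2$ in $D_1\times S^2\subset\mathbb{R}^4$, where $S^2=D_2\cup \overline{D}_2$ and $D_1\times S^2$ is a regular neighbourhood of a standard $2$-sphere. An $n$-chart $\Gamma$ in $D_2$ (an oriented graph with edges labelled in $\{1,\dots,n-1\}$) describes a simple surface braid whose branch points are over the degree-one vertices (black vertices) of $\Gamma$, and whose braid over a path transverse to $\Gamma$ and avoiding its vertices is the intersection word: reading along the path, write $\sigma_i$ (resp. $\sigma_i^{-1}$) for each intersection with an edge of label $i$ oriented from right to left (resp. left to right). $F(\Gamma)$ is the closure of this surface braid; it is determined up to ambient isotopy by the monodromy below. **The charts.** Each chart has black vertices $y_1,\dots,y_8$, lying on edges of labels $k_1,\dots,k_8$, and disjoint (except at their common end) arcs $\alpha_i$ from near $y_i$ to a base point $y_0\in\partial D_2$, appearing in this order around $y_0$, with intersection words $w_i\in B_4$. With $\eta_i$ the loop going from $y_0$ along $\alpha_i$ reversed, once around $y_i$, and back along $\alpha_i$, the monodromy of $\eta_i$ is $w_i^{-1}\sigma_{k_i}^{\varepsilon_i}w_i$, and the product of these eight braids, $i=1,\dots,8$ in order, is trivial. - $T_k$ ($k\ge1$): labels $(1,1,3,3,1,1,3,3)$; $w_1=w_8=1$, $w_2=\sigma_2^{-(k+1)}\sigma_1\sigma_2^2$, $w_3=\sigma_2^{-2}\sigma_1\sigma_2^2$, $w_4=w_5=\sigma_2^{-(k+1)}\sigma_3\sigma_1\sigma_2^2$, $w_6=\sigma_2^{-2}\sigma_3\sigma_2^2$,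 $w_7=\sigma_2^{-(k+1)}\sigma_3\sigma_2^2$; signs $(-,+,-,+,-,+,-,+)$. - $T_k^*$ ($k\ge1$): obtained from $T_k$ by interchanging the labels $1$ and $3$ (so $\sigma_1\leftrightarrow\sigma_3$ in all words and $1\leftrightarrow 3$ in the labels $k_i$). - $T_0$: labels $(1,2,2,3,1,2,2,3)$; $w_1=w_8=1$, $w_2=w_3=\sigma_1\sigma_2^{-1}$, $w_4=w_5=\sigma_2^{-1}\sigma_3\sigma_1\sigma_2^{-1}$, $w_6=w_7=\sigma_3\sigma_2^{-1}$; signs $(+,-,-,+,-,+,+,-)$. **Presentation of the knot quandle** (Carter–Jelsovsky–Kamada–Langford–Saito). For a braid $b\in B_n$ define the automorphism $Q(b)$ of the free quandle $F_Q\langle x_1,\dots,x_n\rangle$ by $Q(1)=\mathrm{id}$ and, writing $a_j=Q(b)(x_j)$: $Q(\sigma_ib)(x_i)=a_{i+1}\overline{*}a_i$, $Q(\sigma_ib)(x_{i+1})=a_i$; $Q(\sigma_i^{-1}b)(x_i)=a_{i+1}$, $Q(\sigma_i^{-1}b)(x_{i+1})=a_i*a_{i+1}$; and $Q(\sigma_i^{\pm1}b)(x_j)=a_j$ for $j\ne i,i+1$. The knot quandle of $F(\Gamma)$ for each chart above is presented by generators $x_1,\dots,x_4$ and relations $Q(w_i)(x_{k_i})=Q(w_i)(x_{k_i+1})$, $i=1,\dots,8$. *)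

(* Defs.v *)
From mathcomp Require Import all_boot.
From mathcomp Require Import zify.

Set Implicit Arguments.
Unset Strict Implicit.
Unset Printing Implicit Defensive.

(** * Finite quandles *)

(* [qop a b] is a * b. *)
Record quandle := Quandle {
  qsort :> finType;
  qop : qsort -> qsort -> qsort;
  qop_idem : forall a, qop a a = a;
  qop_div : forall a b, exists! x, qop x a = b;
  qop_dist : forall a b c, qop (qop a b) c = qop (qop a c) (qop b c) }.

(* The element i of Q_N = {1, ..., N} is represented by the ordinal i.-1; thus
   N itself is N.-1, and [QN_fun N] is x |-> x * N. *)
Definition QN_fun (N x : nat) : nat :=
  if x.+2 < N then x.+1 else if x.+2 == N then 0 else x.

Lemma QN_fun_lt N (x : 'I_N) : QN_fun N x < N.
Proof. by rewrite /QN_fun; have := ltn_ord x; do 2?case: ifP; lia. Qed.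

Definition QN_op N (x y : 'I_N) : 'I_N :=
  if y.+1 == N then Ordinal (QN_fun_lt x) else x.

Lemma QN_op_last N (x y : 'I_N) : ((QN_op x y).+1 == N) = (x.+1 == N).
Proof.
rewrite /QN_op; case: ifP => //= _; rewrite /QN_fun.
by have := ltn_ord x; do 2?case: ifP; lia.
Qed.

Lemma QN_op_inj N (y : 'I_N) : injective (fun x : 'I_N => QN_op x y).
Proof.
move=> a b; rewrite /QN_op; case: ifP => // _ /(congr1 val) /=.
rewrite /QN_fun => E; apply: val_inj => /=; move: E.
by have := ltn_ord a; have := ltn_ord b; do 4?case: ifP; lia.
Qed.

Lemma QN_idem N (a : 'I_N) : QN_op a a = a.
Proof.
rewrite /QN_op; case: ifP => // /eqP aN; apply: val_inj => /=; rewrite /QN_fun.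
by do 2?case: ifP; lia.
Qed.

Lemma QN_div N (a b : 'I_N) : exists! x, QN_op x a = b.
Proof.
have [g _ gK] := injF_bij (@QN_op_inj N a).
by exists (g b); split=> [|x <-]; [exact: gK | exact/(@QN_op_inj N a)/gK].
Qed.

Lemma QN_dist N (a b c : 'I_N) :
  QN_op (QN_op a b) c = QN_op (QN_op a c) (QN_op b c).
Proof.
have E : ((QN_op b c).+1 == N) = (b.+1 == N) := QN_op_last b c.
apply: val_inj; rewrite [in RHS]/QN_op E.
by rewrite /QN_op; case: (b.+1 == N); case: (c.+1 == N).
Qed.

Definition QN (N : nat) : quandle :=
  Quandle (@QN_idem N) (@QN_div N) (@QN_dist N).

(** * Broken surface diagrams and colorings *)

(* [double Ri Rj Rk]: somewhere along the double curves, Rj is the over-sheet,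
   Ri and Rk are the under-sheets, and the normal of Rj points from Ri to Rk. *)
Record surface_diagram := SurfaceDiagram {
  sheet : finType;
  double : sheet -> sheet -> sheet -> bool }.

Definition Col (Q : quandle) (D : surface_diagram) : {set {ffun sheet D -> Q}} :=
  [set C : {ffun sheet D -> Q} |
    [forall Ri, forall Rj, forall Rk,
      double Ri Rj Rk ==> (qop (C Ri) (C Rj) == C Rk)]].

(** * Charts *)

(* A chart in the disk is put in general position with respect to a sweep of
   the disk by parallel segments, the stills.  It is then the sequence of the
   intersection words of the stills read from left to right, starting and
   ending with the empty word; between two successive stills lies one
   singular point of the sweep, of a kind listed in [local_event]. *)

(* (i, true) is sigma_i and (i, false) is its inverse; i ranges over 1..n-1. *)
Definition letter := (nat * bool)%type.
Definition word := seq letter.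

Definition sg (i : nat) : letter := (i, true).
Definition sgV (i : nat) : letter := (i, false).

(* The word [pre ++ before ++ post] is replaced by [pre ++ after ++ post]. *)
Record event := Event { pre : word; before : word; after : word; post : word }.

Definition source (e : event) : word := pre e ++ before e ++ post e.
Definition target (e : event) : word := pre e ++ after e ++ post e.

Definition local_event (l l' : word) : bool :=
  match l, l' with
  (* black vertex *)
  | [::], [:: _] | [:: _], [::] => true
  (* local extremum of an edge *)
  | [::], [:: a; b] | [:: a; b], [::] => (a.1 == b.1) && (a.2 != b.2)
  (* crossing: vertex of degree 4 *)
  | [:: a; b], [:: c; d] =>
      [&& c == b, d == a & (a.1.+1 < b.1) || (b.1.+1 < a.1)]
  (* white vertex: vertex of degree 6 *)
  | [:: a; b; c], [:: a'; b'; c'] =>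
      [&& c == a, a' == b, b' == a, c' == b, a.2 == b.2 &
          (a.1.+1 == b.1) || (b.1.+1 == a.1)]
  | _, _ => false
  end.

Definition event_ok (n : nat) (e : event) : bool :=
  local_event (before e) (after e) &&
  all (fun a : letter => 0 < a.1 < n) (source e ++ target e).

Definition stills (es : seq event) : seq word :=
  [::] :: [seq target e | e <- es].

Record chart (n : nat) := Chart {
  events :> seq event;
  events_ok : all (event_ok n) events;
  events_chain : stills events = rcons [seq source e | e <- events] [::] }.

(* The base point y_0 is on the right of the stills, and the arc of a black
   vertex y runs from y to the right end of the still at the height of y; its
   intersection word is [post e], and the monodromy of the loop eta around y is
   w^-1 sigma_i^eps w with (w, i, eps) given by [black_arc]: in the braid group,
   the target of the event is its source multiplied by this braid on the right,
   whence the opposite sign for a letter that dies.  Up to isotopy of the disk, any system of disjoint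
   arcs from the black vertices to y_0 is of this form, in the order of the
   sweep. *)
Definition arc_system := seq (word * nat * bool).

Definition black_arc (e : event) : option (word * nat * bool) :=
  match before e, after e with
  | [::], [:: a] => Some (post e, a.1, a.2)
  | [:: a], [::] => Some (post e, a.1, ~~ a.2)
  | _, _ => None
  end.

Definition arcs n (G : chart n) : arc_system := pmap black_arc G.

(** * The surface diagram of F(Gamma) *)

(* F(Gamma) lies in D_1 x S^2 = I x I x S^2 and is projected to I x S^2.  The n
   sheets over a region of the complement of Gamma are stacked in I, and the
   i-th and the (i+1)-st of them cross along the edges of label i.  A [piece]
   is the part of the h-th sheet (h from 0) over the interval of the t-th still
   that follows the first r letters of its word.  A broken sheet is a connected
   union of pieces. *)
Section ChartDiagram.
Variables (n : nat) (G : chart n).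

Definition still_word (t : nat) : word := nth [::] (stills G) t.

Definition piece : finType :=
  ({t : 'I_(size (stills G)) & 'I_(size (still_word t)).+1} * 'I_n)%type.

Definition time (x : piece) : nat := tag x.1.
Definition region (x : piece) : nat := tagged x.1.
Definition height (x : piece) : nat := x.2.

(* Going from the region of x to the region of y within a still, one crosses a
   single edge, which contributes sigma_i to the intersection word. *)
Definition across (i : nat) (x y : piece) : bool :=
  let W := still_word (time x) in
  (time x == time y) &&
  ((region y == (region x).+1) && (nth (sg 0) W (region x) == sg i) ||
   (region x == (region y).+1) && (nth (sg 0) W (region y) == sgV i)).

(* Along sigma_i the sheet at height i (counted from 1) passes under and goes up
   to height i+1, while the sheet at height i+1 passes over and goes down. *)
Definition glue_over (x y : piece) : bool :=
  [exists i : 'I_n,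
    [&& across i x y, height x != i.-1 &
        height y == if height x == i then i.-1 else height x]].

(* A region meeting both the t-th and the (t+1)-st still, away from the part of
   the still modified by the t-th event. *)
Definition glue_time (x y : piece) : bool :=
  let e := nth (Event [::] [::] [::] [::]) G (time x) in
  let p := size (pre e) in
  [&& time y == (time x).+1, height x == height y &
      (region x == region y) && (region x <= p) ||
      (p + size (before e) <= region x) &&
      (region y + size (before e) == region x + size (after e))].

Definition glue (x y : piece) : bool :=
  [|| glue_over x y, glue_over y x, glue_time x y | glue_time y x].

Definition broken_sheets : {set {set piece}} :=
  equivalence_partition (connect glue) [set: piece].

Definition piece_double (x y z : piece) : bool :=
  [exists i : 'I_n,
    [&& across i x z, time y == time x, region y == region x,
        height x == i.-1, height y == i & height z == i]].

Definition broken_sheet : finType := {B : {set piece} | B \in broken_sheets}.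

Definition broken_double (Ri Rj Rk : broken_sheet) : bool :=
  [exists x in val Ri, exists y in val Rj, exists z in val Rk,
    piece_double x y z].

Definition F : surface_diagram := SurfaceDiagram broken_double.

End ChartDiagram.

(** * The charts T_0, T_k and T_k^* *)

(* The list of the (w_i, k_i, epsilon_i), i = 1, ..., 8. *)

Definition T (k : nat) : arc_system :=
  let u := nseq k.+1 (sgV 2) in
  [:: ([::], 1, false);
      (u ++ [:: sg 1; sg 2; sg 2], 1, true);
      ([:: sgV 2; sgV 2; sg 1; sg 2; sg 2], 3, false);
      (u ++ [:: sg 3; sg 1; sg 2; sg 2], 3, true);
      (u ++ [:: sg 3; sg 1; sg 2; sg 2], 1, false);
      ([:: sgV 2; sgV 2; sg 3; sg 2; sg 2], 1, true);
      (u ++ [:: sg 3; sg 2; sg 2], 3, false);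
      ([::], 3, true)].

Definition swap13 (i : nat) : nat :=
  if i == 1 then 3 else if i == 3 then 1 else i.

Definition Tstar (k : nat) : arc_system :=
  [seq ([seq (swap13 s.1, s.2) | s <- a.1.1], swap13 a.1.2, a.2)
    | a : word * nat * bool <- T k].

Definition T0 : arc_system :=
  [:: ([::], 1, true);
      ([:: sg 1; sgV 2], 2, false);
      ([:: sg 1; sgV 2], 2, false);
      ([:: sgV 2; sg 3; sg 1; sgV 2], 3, true);
      ([:: sgV 2; sg 3; sg 1; sgV 2], 1, false);
      ([:: sg 3; sgV 2], 2, true);
      ([:: sg 3; sgV 2], 2, true);
      ([::], 3, false)].

(* Main.v *)
Require Import Defs.
From mathcomp Require Import all_boot.
From mathcomp Require Import zify.

Set Implicit Arguments.
Unset Strict Implicit.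
Unset Printing Implicit Defensive.

(* Colors are transported along the stills by the action of braids on tuples of
   colors.  A coloring of F(Gamma) is determined by the colors x of the n sheets
   over the base point: the piece of height h over a region of a still has the
   h-th entry of Q(w)(x), w being the rest of the word of the still.  Conversely,
   every x spreads to all the stills in this way, and the result is compatible
   with crossings and white vertices by the braid relations, and with a black
   vertex exactly when Q(w)(x_k) = Q(w)(x_{k+1}) for its arc.

   For the eight arcs at hand, the words w_1 and w_8 force x = (a, a, b, b).  If a
   and b do not act on each other, then everything is a permutation of a and b.
   Otherwise one of them is the element N of Q_N, and every full twist of the
   strands 2 and 3 shifts the other one by one step along its cycle, of length
   N - 1; for T_{2m-1} the relations compare two colors m + 1 steps apart. *)

(** * The action of braid words on tuples of colors *)

Section BraidAction.
Variable Q : quandle.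
Implicit Types (p q r x y : Q) (s t : seq Q) (b c : bool) (i j : nat).

(** The default [y] is never reached: division is always possible in a quandle, and [pick] finds its
    unique result. *)
Definition qdiv y x : Q := odflt y [pick z | qop z x == y].

Lemma qdivK x y : qop (qdiv y x) x = y.
Proof.
rewrite /qdiv; case: pickP => [z /eqP //|nz].
by have [z [/eqP Ez _]] := qop_div x y; rewrite nz in Ez.
Qed.

Lemma qop_inj x : injective (fun y : Q => qop y x).
Proof.
by move=> y z E; have [t [_ u]] := qop_div x (qop z x); rewrite -(u y) // -(u z).
Qed.

Lemma qopK x y : qdiv (qop y x) x = y.
Proof. by apply: (@qop_inj x); rewrite qdivK. Qed.

(* [act w] sends (x_1, ..., x_n) to (Q(w)(x_1), ..., Q(w)(x_n)); a crossing is taken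
   from the colors on its right to those on its left. *)
Definition cross b (pq : Q * Q) : Q * Q :=
  if b then (qdiv pq.2 pq.1, pq.1) else (pq.2, qop pq.1 pq.2).

(** Strands are counted from 0 here, while labels start at 1; hence the [.-1] in [act_letter]. A
    crossing out of range leaves the tuple alone. *)
Fixpoint act_at b i s : seq Q :=
  match i, s with
  | 0, p :: q :: t => (cross b (p, q)).1 :: (cross b (p, q)).2 :: t
  | i'.+1, p :: t => p :: act_at b i' t
  | _, _ => s
  end.

Definition act_letter (l : letter) s : seq Q := act_at l.2 l.1.-1 s.

Definition act (w : word) s : seq Q := foldr act_letter s w.

Lemma act_cat v w s : act (v ++ w) s = act v (act w s).
Proof. exact: foldr_cat. Qed.

Lemma size_act_at b i s : size (act_at b i s) = size s.
Proof. by elim: i s => [|i IH] [|p [|q t]] //=; rewrite IH. Qed.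

Lemma size_act w s : size (act w s) = size s.
Proof. by elim: w => //= l w <-; exact: size_act_at. Qed.

Lemma nth_act_at x0 b i s j : i.+1 < size s ->
  nth x0 (act_at b i s) j =
  if j == i then (cross b (nth x0 s i, nth x0 s i.+1)).1
  else if j == i.+1 then (cross b (nth x0 s i, nth x0 s i.+1)).2
  else nth x0 s j.
Proof.
elim: i s j => [|i IH] [|p [|q t]] //= [|j] //= lt_i; first by case: j.
by rewrite IH.
Qed.

Lemma act_atK b i : cancel (act_at (~~ b) i) (act_at b i).
Proof.
elim: i => [|i IH] [|p t] //=; last by rewrite IH.
by case: t => [|q t] //=; case: b => /=; rewrite ?qdivK ?qopK.
Qed.

Lemma act_at_comm b c i j s : i.+1 < j ->
  act_at b i (act_at c j s) = act_at c j (act_at b i s).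
Proof.
elim: i j s => [|i IH] [|[|j]] [|p [|q t]] //= lt_ij; congr cons.
  exact: IH j.+1 [::] lt_ij.
exact: IH j.+1 (q :: t) lt_ij.
Qed.

(** For negative crossings this is self-distributivity of the quandle. The positive case is its
    inverse: [s] is rewritten as the image of the right-hand side [u] under three negative
    crossings. *)
Lemma act_at_braid b i s : i.+2 < size s ->
  act_at b i (act_at b i.+1 (act_at b i s)) =
  act_at b i.+1 (act_at b i (act_at b i.+1 s)).
Proof.
have neg t : i.+2 < size t -> act_at false i (act_at false i.+1 (act_at false i t)) =
                              act_at false i.+1 (act_at false i (act_at false i.+1 t)).
  elim: i t => [|j IH] [|p t] //= lt_j; last by congr cons; exact: IH.
  by case: t lt_j => [|q [|r t]] //= _; rewrite qop_dist.
case: b => [lt_i|]; last exact: neg.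
have K j : cancel (act_at true j) (act_at false j) := @act_atK false j.
have K' j : cancel (act_at false j) (act_at true j) := @act_atK true j.
set u := RHS; have lt_u : i.+2 < size u by rewrite !size_act_at.
have -> : s = act_at false i.+1 (act_at false i (act_at false i.+1 u)) by rewrite !K.
by rewrite -neg // !K'.
Qed.

Lemma cross_eq b p : cross b (p, p) = (p, p).
Proof. by rewrite /cross; case: b => /=; rewrite -{1}(qop_idem p) ?qopK ?qop_idem. Qed.

(** One output of a crossing is an unchanged copy of the other strand's color, so a fixed tuple has
    equal entries there; the converse is idempotence. This turns the relation at a black vertex into
    invariance under its letter. *)
Lemma act_letter_fix x0 b i s : 0 < i < size s ->
  (act_letter (i, b) s == s) = (nth x0 s i.-1 == nth x0 s i).
Proof.
case: i => // i /= lt_i; rewrite /act_letter /=; apply/eqP/eqP => [E|E].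
  move: (congr1 (fun t => nth x0 t i) E) (congr1 (fun t => nth x0 t i.+1) E).
  rewrite !nth_act_at // !eqxx (_ : (i.+1 == i) = false); last by lia.
  by rewrite /cross; case: b E.
apply: (@eq_from_nth _ x0); rewrite size_act_at // => j _.
by rewrite nth_act_at // -E cross_eq /=; case: eqP => [->//|_]; case: eqP => [->|].
Qed.

End BraidAction.

(** * Events of the sweep as identities between actions *)

Section Relations.
Variables (Q : quandle) (x0 : Q).

(* The relation Q(w)(x_k) = Q(w)(x_{k+1}) at the black vertex of an arc. *)
Definition arc_rel (x : seq Q) (a : word * nat * bool) : bool :=
  nth x0 (act a.1.1 x) a.1.2.-1 == nth x0 (act a.1.1 x) a.1.2.

(** An extremum is the cancellation of inverse letters, a crossing is far commutation, a white
    vertex is the braid relation, and a black vertex is [act_letter_fix]. *)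
Lemma act_event n e (x : seq Q) : event_ok n e -> size x = n ->
  oapp (arc_rel x) true (black_arc e) ->
  act (before e ++ post e) x = act (after e ++ post e) x.
Proof.
case: e => pr l l' w /andP[/= le /allP ok] sx; rewrite !act_cat /=.
have {}ok a : (a \in l) || (a \in l') -> 0 < a.1 < size (act w x).
  rewrite size_act sx => a_in; apply: ok; rewrite /source /target /= !mem_cat.
  by case/orP: a_in => ->; rewrite !orbT.
have inv (a b : letter) s : (a.1 == b.1) && (a.2 != b.2) ->
    act [:: a; b] s = s :> seq Q.
  case: a b => [i b] [j c] /= /andP[/eqP <- bc].
  by rewrite /act_letter /= (_ : c = ~~ b) ?act_atK //; case: b c bc => [] [].
rewrite /black_arc /=; move: l l' le ok => [|a [|b [|c [|? ?]]]] [|a' [|b' [|c' [|? ?]]]] //=.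
- case: a' => [i b] _ ok; rewrite /arc_rel /= -(act_letter_fix _ b).
    by move/eqP->.
  by apply: (ok (i, b)); rewrite mem_head.
- by move=> le _ _; apply/esym/(inv a' b').
- case: a => [i b] _ ok; rewrite /arc_rel /= -(act_letter_fix _ b).
    by move/eqP->.
  by apply: (ok (i, b)); rewrite mem_head.
- by move=> le _ _; apply: (inv a b).
- case: a => [i b0]; case: b => [j c] /and3P[/eqP-> /eqP->] /= ij ok _.
  have := ok (i, b0); have := ok (j, c); rewrite !inE !eqxx ?orbT /= => /(_ isT) lt_j /(_ isT) lt_i.
  rewrite /act_letter /=; case/orP: ij => ij; last symmetry; apply: act_at_comm; lia.
case: a b c a' b' c' => [i d] [j f] c a' b' c' /and5P[/eqP-> /eqP-> /eqP-> /eqP->] /=.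
move=> /andP[/eqP <-] ij ok _.
have := ok (i, d); have := ok (j, d); rewrite !inE !eqxx ?orbT /= => /(_ isT) lt_j /(_ isT) lt_i.
rewrite /act_letter /=; case/orP: ij => /eqP ij.
  have [m Ei] : exists m, i = m.+1 by exists i.-1; lia.
  by rewrite -ij Ei /= act_at_braid // ; lia.
have [m Ej] : exists m, j = m.+1 by exists j.-1; lia.
by rewrite -ij Ej /= act_at_braid //; lia.
Qed.

(** The converse at black vertices, by which a given coloring yields the relations. *)
Lemma black_arc_rel n e (x : seq Q) : event_ok n e -> size x = n ->
  act (before e ++ post e) x = act (after e ++ post e) x ->
  oapp (arc_rel x) true (black_arc e).
Proof.
case: e => pr l l' w /andP[/= le /allP ok] sx; rewrite !act_cat /=.
rewrite /black_arc /source /target /= in ok *.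
case: l l' le ok => [|[i b] [|? ?]] [|[i' b'] [|? ?]] //= _ ok => [/esym|] E.
  rewrite /arc_rel /= -(act_letter_fix _ b') ?E // size_act sx.
  by apply: (ok (i', b')); rewrite !mem_cat mem_head ?orbT.
rewrite /arc_rel /= -(act_letter_fix _ b) ?E // size_act sx.
by apply: (ok (i, b)); rewrite !mem_cat mem_head ?orbT.
Qed.

End Relations.

(** * Pieces of the diagram and the colors spread from the base point *)

Section Diagram.
Variables (n : nat) (G : chart n).

Let e0 := Event [::] [::] [::] [::].

Lemma size_stills : size (stills G) = (size G).+1.
Proof. by rewrite /= size_map. Qed.

Lemma still_source t : t < size G -> still_word G t = source (nth e0 G t).
Proof.
by move=> lt_t; rewrite /still_word events_chain nth_rcons size_map lt_t (nth_map e0).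
Qed.

Lemma still_target t : t < size G -> still_word G t.+1 = target (nth e0 G t).
Proof. by move=> lt_t; rewrite /still_word /stills /= (nth_map e0). Qed.

Lemma nth_event_ok t : t < size G -> event_ok n (nth e0 G t).
Proof. exact: (all_nthP e0 (events_ok G)). Qed.

Lemma still_letter_ok t r : t < size (stills G) -> r < size (still_word G t) ->
  0 < (nth (sg 0) (still_word G t) r).1 < n.
Proof.
rewrite size_stills; case: t => // t lt_t; rewrite still_target // => lt_r.
have /andP[_ /allP ok] := nth_event_ok lt_t.
by apply: ok; rewrite mem_cat mem_nth ?orbT.
Qed.

Lemma time_lt (x : piece G) : time x < size (stills G).
Proof. exact: ltn_ord. Qed.

Lemma region_le (x : piece G) : region x <= size (still_word G (time x)).
Proof. by rewrite -ltnS; exact: ltn_ord. Qed.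

Lemma height_lt (x : piece G) : height x < n.
Proof. exact: ltn_ord. Qed.

Lemma piece_exists t r h : t < size (stills G) -> r <= size (still_word G t) ->
  h < n -> exists x : piece G, [/\ time x = t, region x = r & height x = h].
Proof.
move=> lt_t; rewrite -ltnS => lt_r lt_h.
pose T := Tagged (fun t : 'I_(size (stills G)) => 'I_(size (still_word G t)).+1).
by exists (T (Ordinal lt_t) (Ordinal lt_r), Ordinal lt_h).
Qed.

Lemma piece_inj (x y : piece G) :
  time x = time y -> region x = region y -> height x = height y -> x = y.
Proof.
case: x y => [[t r] h] [[t' r'] h'] Et.
have {}Et : t = t' := ord_inj Et.
case: t' / Et r' => r' Er Eh.
by have -> : r = r' := ord_inj Er; have -> : h = h' := ord_inj Eh.
Qed.

(** Crossings are directed along [sigma_i]: rightwards in the still for [sigma_i], leftwards for its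
    inverse. The offsets [~~ b] and [b], read as 0 or 1, cover both cases. *)
Lemma across_exists t r h h' i b : t < size (stills G) ->
    r < size (still_word G t) -> h < n -> h' < n ->
    nth (sg 0) (still_word G t) r = (i, b) ->
  exists p q : piece G,
    [/\ time p = t, time q = t, region p = r + ~~ b, region q = r + b
      & (height p = h /\ height q = h') /\ across i p q].
Proof.
move=> lt_t lt_r lt_h lt_h' l_r.
have [|p [tp rp hp]] := @piece_exists t (r + ~~ b) h lt_t _ lt_h; first by case: b l_r; lia.
have [|q [tq rq hq]] := @piece_exists t (r + b) h' lt_t _ lt_h'; first by case: b l_r rp; lia.
exists p, q; split=> //; split=> //; rewrite /across tp tq eqxx rp rq /=.
case: b l_r {rp rq} => l_r; rewrite /= addn0 addn1 l_r !eqxx //.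
by rewrite orbT.
Qed.

Variables (Q : quandle) (x0 : Q).

Definition state (x : seq Q) (p : piece G) : seq Q :=
  act (drop (region p) (still_word G (time p))) x.

Definition spread (x : seq Q) (p : piece G) : Q := nth x0 (state x p) (height p).

Lemma size_state x p : size (state x p) = size x.
Proof. exact: size_act. Qed.

Lemma across_letter i (p q : piece G) : across i p q -> 0 < i < n.
Proof.
case/andP=> /eqP tpq; have := region_le q; have := region_le p; have := time_lt p.
rewrite -tpq => lt_t le_p le_q.
by case/orP=> /andP[/eqP E /eqP l_r]; have := @still_letter_ok _ _ lt_t; rewrite E in le_p le_q;
  [move/(_ _ le_q) | move/(_ _ le_p)]; rewrite l_r.
Qed.

(** The letter is negative whatever its sign in the still: colors are transported along [sigma_i],
    whereas [act] carries them from right to left, and for an inverse letter the two directions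
    agree. *)
Lemma across_state x i (p q : piece G) :
  across i p q -> state x q = act_letter (sgV i) (state x p).
Proof.
case/andP=> /eqP tpq; have := region_le q; have := region_le p.
rewrite /state -tpq => le_p le_q; case/orP=> /andP[/eqP E /eqP l_r]; rewrite E in le_p le_q *.
  by rewrite [in RHS](drop_nth (sg 0) le_q) l_r; apply/esym; exact: (@act_atK _ false).
by rewrite (drop_nth (sg 0) le_p) l_r.
Qed.

Lemma spread_glue_over x (p q : piece G) : size x = n ->
  glue_over p q -> spread x p = spread x q.
Proof.
move=> sx /existsP[[i /= _] /and3P[a_i hp /eqP hq]]; have /andP[i0 lt_i] := across_letter a_i.
rewrite /spread hq (across_state x a_i) /act_letter /= nth_act_at ?size_state ?sx ?prednK //.
by case: (boolP (height p == i)) => [/eqP ->|hi]; rewrite ?eqxx // (negPf hp) (negPf hi).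
Qed.

Lemma spread_double x (p q r : piece G) : size x = n ->
  piece_double p q r -> qop (spread x p) (spread x q) = spread x r.
Proof.
move=> sx /existsP[[i /= _] /and5P[a_i /eqP tq /eqP rq /eqP hp /andP[/eqP hq /eqP hr]]].
have /andP[i0 lt_i] := across_letter a_i.
have sq : state x q = state x p by rewrite /state tq rq.
rewrite /spread hp hq hr sq (across_state x a_i) /act_letter /=.
rewrite nth_act_at ?size_state ?sx ?prednK //.
by rewrite eqxx (_ : (i == i.-1) = false) //; lia.
Qed.

Lemma spread_glue_time x (p q : piece G) : size x = n ->
  all (arc_rel x0 x) (arcs G) -> glue_time p q -> spread x p = spread x q.
Proof.
move=> sx rel /and3P[/eqP tq /eqP hpq]; rewrite /spread /state hpq tq.
have lt_t : time p < size G by have := time_lt q; rewrite size_stills tq.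
rewrite still_source // still_target // -/e0.
move: rel; rewrite all_pmap => /(all_nthP e0)/(_ _ lt_t); have := nth_event_ok lt_t.
move: (nth e0 G (time p)) => e e_ok rel pq.
suff -> : act (drop (region p) (source e)) x = act (drop (region q) (target e)) x by [].
(* To the left of the event the rest of the word contains the event and [act_event] applies; to its
   right the rest of the word is the same in both stills. *)
case/orP: pq => /andP[].
  move=> /eqP <- le_p; rewrite /source /target !(drop_cat _ (pre e)).
  rewrite leq_eqVlt in le_p; case/orP: le_p => [/eqP->|lt_p].
    rewrite ltnn subnn !drop0; exact: (act_event (x0 := x0) e_ok sx).
  by rewrite lt_p !act_cat -!(act_cat _ (post e)) (act_event (x0 := x0) e_ok sx).
move=> le_p /eqP E; rewrite /source /target !catA !drop_cat !size_cat.
rewrite ltnNge le_p /= (_ : (region q < _) = false); last by lia.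
by congr (act (drop _ _) _); lia.
Qed.

(** * A coloring of the pieces is determined by its base colors *)

Section Coloring.
Variable f : piece G -> Q.
Hypothesis f_glue : forall x y, glue x y -> f x = f y.
Hypothesis f_double : forall x y z, piece_double x y z -> qop (f x) (f y) = f z.
Variable x : seq Q.
Hypothesis size_x : size x = n.
Hypothesis f_base : forall p, time p = 0 -> f p = nth x0 x (height p).

(** Two inductions: over the stills for the region at the right end, which persists from one still
    to the next, then leftwards within a still, one letter at a time. *)
Lemma f_spread p : f p = spread x p.
Proof.
have last t q : time q = t -> region q = size (still_word G t) -> f q = nth x0 x (height q).
  elim: t q => [|t IH] q tq rq; first exact: f_base.
  have lt_t : t < size G by have := time_lt q; rewrite size_stills tq.
  have [|//||p' [tp rp hp]] := @piece_exists t (size (still_word G t)) (height q);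
    [by rewrite size_stills; lia | exact: height_lt | ].
  have p'q : glue_time p' q.
    rewrite /glue_time -/e0 tp tq hp rp rq !eqxx still_source // still_target //=.
    by rewrite /source /target !size_cat; apply/orP; right; apply/andP; split; lia.
  by rewrite -hp -IH //; apply/esym/f_glue; rewrite /glue p'q !orbT.
have [d le_d] := ubnP (size (still_word G (time p)) - region p).
elim: d p le_d => // d IH p le_d; have := region_le p; rewrite leq_eqVlt.
case/orP=> [/eqP rp | lt_r].
  by rewrite (last (time p)) // /spread /state rp drop_size.
set W := still_word G (time p) in le_d lt_r; set r := region p.
have /= := still_letter_ok (time_lt p) lt_r; rewrite -/W -/r.
have next q : time q = time p -> region q = r.+1 -> f q = spread x q.
  by move=> tq rq; apply: IH; rewrite tq rq -/W; lia.
have pE q : time q = time p -> region q = r -> height q = height p -> q = p.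
  exact: piece_inj.
have over i (y z : piece G) : i < n -> across i y z -> height y != i.-1 ->
    height z = (if height y == i then i.-1 else height y) ->
    f y = f z /\ spread x y = spread x z.
  move=> lt_i a_i hy hz; have yz : glue_over y z.
    by apply/existsP; exists (Ordinal lt_i); rewrite a_i hy hz eqxx.
  by split; [apply: f_glue; rewrite /glue yz | apply: spread_glue_over].
have dbl i (y o z : piece G) : i < n -> across i y z -> time o = time y ->
    region o = region y -> height y = i.-1 -> height o = i -> height z = i ->
    qop (f y) (f o) = f z /\ qop (spread x y) (spread x o) = spread x z.
  move=> lt_i a_i to ro hy ho hz; have yoz : piece_double y o z.
    apply/existsP; exists (Ordinal lt_i).
    by rewrite /= a_i hy ho hz to ro !eqxx.
  by split; [apply: f_double yoz | apply: spread_double].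
have hp := height_lt p.
case El: (nth _ W r) => [k b] /= /andP[k0 lt_k].
have ex h h' lt_h lt_h' := @across_exists (time p) r h h' k b (time_lt p) lt_r lt_h lt_h' El.
have lt_k' : k.-1 < n by lia.
case: b {El} ex => /= ex.
  (* Here [p] is the incoming under-sheet, so its color is known only through its product with that
     of the over-sheet [y]. As [y] continues to the next region as [z], its color is known and can
     be cancelled. *)
  have [hk | hk] := eqVneq (height p) k.-1.
    have [y [z [ty tz ry rz [[hy hz] a_yz]]]] := ex k k.-1 lt_k lt_k'.
    have [p' [z' [tp tz' rp rz' [[hp' hz'] a_pz]]]] := ex k.-1 k lt_k' lt_k.
    rewrite addn0 in rp; rewrite (pE p') ?hk // in a_pz.
    have [fy sy] : f y = f z /\ spread x y = spread x z.
      by apply: over a_yz _ _; rewrite // hy ?eqxx //; lia.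
    have [fp sp] : qop (f p) (f y) = f z' /\ qop (spread x p) (spread x y) = spread x z'.
      by apply: dbl a_pz _ _ _ _ _; rewrite // ry addn0.
    apply: (@qop_inj _ (f y)); rewrite fp next ?rz' ?addn1 // -sp.
    by rewrite fy next ?rz ?addn1 // sy.
  have lt_h : (if height p == k then k.-1 else height p) < n by case: ifP.
  have [p' [z [tp tz rp rz [[hp' hz] a_pz]]]] := ex _ _ hp lt_h.
  rewrite addn0 in rp; rewrite (pE p') // in a_pz.
  have [-> ->] := over _ _ _ lt_k a_pz hk hz.
  by apply: next; rewrite // rz addn1.
(* For an inverse letter the crossing runs from the next region into that of [p], so the
   double-point relation gives the color of [p] directly. *)
have [hk | hk] := eqVneq (height p) k.
  have [y [p' [ty tp ry rp [[hy hp'] a_yp]]]] := ex k.-1 k lt_k' lt_k.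
  have [o [_ [to _ ro _ [[ho _] _]]]] := ex k k lt_k lt_k.
  rewrite addn0 in rp; rewrite (pE p') ?hk // in a_yp.
  have [<- <-] : qop (f y) (f o) = f p /\ qop (spread x y) (spread x o) = spread x p.
    by apply: dbl a_yp _ _ _ _ _; rewrite // ?ty // ry.
  by rewrite !next // ?ro ?ry addn1.
have lt_h : (if height p == k.-1 then k else height p) < n by case: ifP.
have [y [p' [ty tp ry rp [[hy hp'] a_yp]]]] := ex _ _ lt_h hp.
rewrite addn0 in rp; rewrite (pE p') // in a_yp.
have [<- <-] : f y = f p /\ spread x y = spread x p.
  apply: over a_yp _ _; rewrite // hy; first by case: ifP => [_|/negbT //]; lia.
  by case: (boolP (height p == k.-1)) => [/eqP ->|_]; rewrite ?eqxx // (negPf hk).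
by apply: next; rewrite // ry addn1.
Qed.

(** The region just left of an event meets both neighboring stills, so each sheet keeps its color
    there; comparing the two states gives the hypothesis of [black_arc_rel]. *)
Lemma f_arc_rel : all (arc_rel x0 x) (arcs G).
Proof.
have spread_time p q : glue_time p q -> spread x p = spread x q.
  by move=> pq; rewrite -!f_spread; apply: f_glue; rewrite /glue pq !orbT.
rewrite all_pmap; apply/(all_nthP e0) => t lt_t.
set e := nth e0 G t; have Ee : e = nth e0 G t by [].
apply: (@black_arc_rel _ _ n) => //; first by rewrite Ee nth_event_ok.
apply: (@eq_from_nth _ x0); rewrite !size_act // size_x => h lt_h.
have lt_t1 : t.+1 < size (stills G) by rewrite size_stills.
have [||//|p [tp rp hp]] := @piece_exists t (size (pre e)) h; first exact: ltnW.
  by rewrite still_source // -Ee /source size_cat leq_addr.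
have [|//|q [tq rq hq]] := @piece_exists t.+1 (size (pre e)) h lt_t1.
  by rewrite still_target // -Ee /target size_cat leq_addr.
have := spread_time p q; rewrite /spread /state tp tq rp rq hp hq.
rewrite still_source // still_target // -Ee /source /target !drop_size_cat //.
by apply; rewrite /glue_time tp tq hp hq rp rq -/e0 -Ee !eqxx leqnn.
Qed.

End Coloring.

(** * From pieces to broken sheets, and the count of colorings *)

Definition sheet_of (p : piece G) : sheet (F G) :=
  exist _ [set q in [set: piece G] | connect (@glue n G) p q]
    (imset_f (fun p => [set q in [set: piece G] | connect (@glue n G) p q]) (in_setT p)).

Lemma glue_sym : symmetric (@glue n G).
Proof.
move=> p q; rewrite /glue orbA [glue_over p q || _]orbC -!orbA.
by congr [|| _, _ | _]; rewrite orbC.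
Qed.

Lemma connect_glue_sym : connect_sym (@glue n G).
Proof. exact: sym_connect_sym glue_sym. Qed.

Lemma mem_sheet_of p q : (q \in val (sheet_of p)) = connect (@glue n G) p q.
Proof. by rewrite !inE. Qed.

Lemma sheet_of_eq p q : connect (@glue n G) p q -> sheet_of p = sheet_of q.
Proof.
move=> pq; apply: val_inj; apply/setP => r; rewrite !mem_sheet_of.
exact: (same_connect (connect_glue_sym) pq).
Qed.

Lemma sheet_of_surj (S : sheet (F G)) p : p \in val S -> S = sheet_of p.
Proof.
case: S => S /= S_in pS; have [q _ E] := imsetP S_in.
rewrite E !inE /= in pS; rewrite -(sheet_of_eq pS); exact: val_inj.
Qed.

Lemma sheet_nonempty (S : sheet (F G)) : exists p, p \in val S.
Proof.
case: S => S /= S_in; have [q _ E] := imsetP S_in.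
by exists q; rewrite E !inE connect0.
Qed.

(** The initial still is empty, so its single region also lies at the right end, next to the base
    point. *)
Definition base_piece (h : 'I_n) : piece G :=
  (Tagged (fun t : 'I_(size (stills G)) => 'I_(size (still_word G t)).+1)
     (ord0 : 'I_(size (still_word G ord0)).+1), h).

Lemma base_pieceE (p : piece G) : time p = 0 -> p = base_piece (Ordinal (height_lt p)).
Proof.
by move=> tp; apply: piece_inj => //; have := region_le p; rewrite tp; case: region.
Qed.

Lemma spread_glue x p q : size x = n -> all (arc_rel x0 x) (arcs G) ->
  glue p q -> spread x p = spread x q.
Proof.
move=> sx rel /or4P[] g.
- exact: spread_glue_over.
- exact/esym/spread_glue_over.
- exact: spread_glue_time.
- exact/esym/spread_glue_time.
Qed.

Definition base_colors (C : {ffun sheet (F G) -> Q}) : n.-tuple Q :=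
  [tuple C (sheet_of (base_piece h)) | h < n].

Lemma ColP (C : {ffun sheet (F G) -> Q}) : reflect
  (forall p q r, piece_double p q r ->
     qop (C (sheet_of p)) (C (sheet_of q)) = C (sheet_of r)) (C \in Col Q (F G)).
Proof.
rewrite inE; apply: (iffP forallP) => [HC p q r d | HC R1].
  have /forallP/(_ (sheet_of q))/forallP/(_ (sheet_of r))/implyP := HC (sheet_of p).
  move=> H; apply/eqP; apply: H; rewrite /= /broken_double.
  apply/existsP; exists p; rewrite mem_sheet_of connect0 /=.
  apply/existsP; exists q; rewrite mem_sheet_of connect0 /=.
  by apply/existsP; exists r; rewrite mem_sheet_of connect0.
apply/forallP=> R2; apply/forallP=> R3; apply/implyP.
case/existsP=> p /andP[/sheet_of_surj-> /existsP[q /andP[/sheet_of_surj->]]].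
by case/existsP=> r /andP[/sheet_of_surj-> d]; apply/eqP/HC.
Qed.

Lemma Col_spread (C : {ffun sheet (F G) -> Q}) : C \in Col Q (F G) ->
  (forall p, C (sheet_of p) = spread (base_colors C) p) /\
  all (arc_rel x0 (base_colors C)) (arcs G).
Proof.
move/ColP=> HC; have gl p q : glue p q -> C (sheet_of p) = C (sheet_of q).
  by move=> /connect1/sheet_of_eq ->.
have base p : time p = 0 -> C (sheet_of p) = nth x0 (base_colors C) (height p).
  move=> /base_pieceE {1}->; rewrite -[height p]/(nat_of_ord (Ordinal (height_lt p))).
  by rewrite -tnth_nth tnth_mktuple.
have sx := size_tuple (base_colors C); split=> [p|].
  exact: (f_spread gl HC sx base).
exact: (f_arc_rel gl HC sx base).
Qed.

(** This is the presentation of the knot quandle, read as a count of homomorphisms to [Q].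
    Restriction to the base is injective by [Col_spread]; it is onto because [spread] is constant on
    each sheet, so any chosen piece may define the color of its sheet. *)
Lemma card_Col :
  #|Col Q (F G)| = #|[set x : n.-tuple Q | all (arc_rel x0 x) (arcs G)]|.
Proof.
rewrite -(card_in_imset (f := base_colors)); last first.
  move=> C C' /Col_spread[EC _] /Col_spread[EC' _] E; apply/ffunP => S.
  by have [p /sheet_of_surj ->] := sheet_nonempty S; rewrite EC EC' E.
apply: eq_card => x; rewrite inE; apply/imsetP/idP => [[C /Col_spread[_ rel] ->] //|rel].
have sx := size_tuple x.
pose C := [ffun S : sheet (F G) => spread x (xchoose (sheet_nonempty S))].
have CE p : C (sheet_of p) = spread x p.
  rewrite ffunE; have := xchooseP (sheet_nonempty (sheet_of p)).
  rewrite mem_sheet_of => /connectP[s pth ->]; elim: s p pth => //= q s IH p /andP[pq /IH ->].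
  exact/esym/spread_glue.
exists C; first by apply/ColP => p q r d; rewrite !CE; exact: spread_double.
apply: eq_from_tnth => h; rewrite tnth_mktuple CE /spread /state.
by rewrite (tnth_nth x0).
Qed.

End Diagram.

(** * Full twists of strands 2 and 3 *)

Section Twists.
Variable Q : quandle.
Implicit Types p q r s : Q.

Lemma nseq_doubleS (A : Type) m (l : A) : nseq m.+1.*2 l = nseq m.*2 l ++ [:: l; l].
Proof. by rewrite doubleS -addn2 nseqD. Qed.

(** Each pair of crossings multiplies [r] by [q] and restores [q]; by distributivity and
    idempotence, [q] is still fixed by the new [r]. *)
Lemma act_twist_l m p q r s : qop q r = q ->
  act (nseq m.*2 (sgV 2)) [:: p; q; r; s] = [:: p; q; iter m (fun x => qop x q) r; s].
Proof.
elim: m r => // m IH r qr.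
rewrite nseq_doubleS act_cat iterSr /= /act_letter /= qr IH //.
by rewrite -{1}(qop_idem q) -qop_dist qr qop_idem.
Qed.

Lemma act_twist_r m p q r s : qop r q = r ->
  act (nseq m.*2 (sgV 2)) [:: p; q; r; s] = [:: p; iter m (fun x => qop x r) q; r; s].
Proof.
have rqr x : qop r x = r -> qop r (qop x r) = r.
  by move=> rx; rewrite -{1}(qop_idem r) -qop_dist rx qop_idem.
elim: m q => // m IH q rq; rewrite nseq_doubleS act_cat iterSr /= /act_letter /= rqr //.
by rewrite IH ?rqr.
Qed.

End Twists.

(** * Reduction from 4-tuples to pairs of colors *)

Section Pairs.
Variables (Q : quandle) (x0 : Q) (R : arc_system).

Lemma card_pairs : ([::], 1) \in [seq a.1 | a <- R] -> ([::], 3) \in [seq a.1 | a <- R] ->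
  #|[set x : 4.-tuple Q | all (arc_rel x0 x) R]| =
  #|[set ab : Q * Q | all (arc_rel x0 [:: ab.1; ab.1; ab.2; ab.2]) R]|.
Proof.
move=> /mapP[r1 R1 E1] /mapP[r3 R3 E3].
rewrite -[RHS](card_imset _ (f := fun ab => [tuple ab.1; ab.1; ab.2; ab.2])); last first.
  by case=> [a b] [a' b'] /(congr1 val) [-> _ -> _].
apply: eq_card => x; rewrite inE; apply/idP/imsetP => [rel|[ab ab_in ->]]; last first.
  by rewrite inE in ab_in.
move/allP: (rel) => rel'; have := rel' _ R3; have := rel' _ R1.
rewrite /arc_rel -E1 -E3 /=; case: x rel {rel'} => [[|p [|q [|r [|s [|? ?]]]]]] //= sz rel.
move=> /eqP pq /eqP rs; subst q s; exists (p, r); first by rewrite inE.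
exact: val_inj.
Qed.

End Pairs.

(* The element N, the only one that acts nontrivially. *)
Definition star N (x : QN N) : bool := x.+1 == N.

(** * Arithmetic of [QN] *)

Section QNAction.
Variable N : nat.
Implicit Types x y z : QN N.

Lemma star_qop x y : star (qop x y) = star x.
Proof. exact: QN_op_last. Qed.

Lemma star_qdiv x y : star (qdiv x y) = star x.
Proof. by rewrite -{2}(qdivK y x) star_qop. Qed.

Lemma qop_nstar x y : ~~ star y -> qop x y = x.
Proof. by rewrite /= /QN_op /star => /negPf ->. Qed.

Lemma star_eq x y : star x -> star y -> x = y.
Proof. by move=> /eqP Ex /eqP Ey; apply: val_inj; apply: succn_inj; rewrite Ex Ey. Qed.

Lemma star_op x y : star x -> qop x y = x.
Proof.
by move=> sx; case: (boolP (star y)) => [sy|/qop_nstar //]; rewrite (star_eq sx sy) qop_idem.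
Qed.

Lemma val_qop_star x z : star z -> qop x z = QN_fun N x :> nat.
Proof. by rewrite /= /QN_op /star => ->. Qed.

(** Away from the last element, [QN_fun] is the successor modulo [N - 1]. *)
Lemma val_iter_star m x z : star z -> ~~ star x ->
  nat_of_ord (iter m (fun y => qop y z) x) = (x + m) %% (N - 1).
Proof.
move=> sz nx; have lt_x := ltn_ord x; rewrite /star in nx.
elim: m => [|m IH]; first by rewrite addn0 modn_small //=; lia.
rewrite iterS val_qop_star // /QN_fun IH addnS -[(x + m).+1]addn1 -[in RHS]modnDml addn1.
have : (x + m) %% (N - 1) < N - 1 by rewrite ltn_mod; lia.
move: ((x + m) %% (N - 1)) => v lt_v; case: ifP => [lt_v2|]; first by rewrite modn_small; lia.
case: eqP => [E _|]; last by lia.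
by rewrite (_ : v.+1 = N - 1) ?modnn //; lia.
Qed.

Lemma card_star_eq : 0 < N ->
  #|[set ab : QN N * QN N | star ab.1 == star ab.2]| = (N - 1) ^ 2 + 1.
Proof.
move=> N0; pose S := [set x | @star N x].
have cS : #|S| = 1.
  have lt_N : N.-1 < N by lia.
  apply/eqP/cards1P; exists (Ordinal lt_N : QN N); apply/setP=> x; rewrite !inE /star.
  apply/eqP/eqP => [E|->]; last by rewrite /= prednK.
  by apply: val_inj => /=; lia.
have -> : [set ab : QN N * QN N | star ab.1 == star ab.2] = setX S S :|: setX (~: S) (~: S).
  by apply/setP => -[a b]; rewrite !inE /=; case: (star a); case: (star b).
rewrite cardsU (_ : _ :&: _ = set0).
  by rewrite cards0 subn0 !cardsX [#|~: S|]cardsCs setCK cS card_ord mulnn; lia.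
by apply/setP => -[a b]; rewrite !inE /=; case: (star a); rewrite ?andbF.
Qed.

End QNAction.

(** The twist word is abstracted so that it can stay opaque during simplification, with only its
    action on tuples known. *)
Definition T_with (u : word) : arc_system :=
  [:: ([::], 1, false);
      (u ++ [:: sg 1; sg 2; sg 2], 1, true);
      ([:: sgV 2; sgV 2; sg 1; sg 2; sg 2], 3, false);
      (u ++ [:: sg 3; sg 1; sg 2; sg 2], 3, true);
      (u ++ [:: sg 3; sg 1; sg 2; sg 2], 1, false);
      ([:: sgV 2; sgV 2; sg 3; sg 2; sg 2], 1, true);
      (u ++ [:: sg 3; sg 2; sg 2], 3, false);
      ([::], 3, true)].

Definition Tstar_with (u : word) : arc_system :=
  [:: ([::], 3, false);
      (u ++ [:: sg 3; sg 2; sg 2], 3, true);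
      ([:: sgV 2; sgV 2; sg 3; sg 2; sg 2], 1, false);
      (u ++ [:: sg 1; sg 3; sg 2; sg 2], 1, true);
      (u ++ [:: sg 1; sg 3; sg 2; sg 2], 3, false);
      ([:: sgV 2; sgV 2; sg 1; sg 2; sg 2], 3, true);
      (u ++ [:: sg 1; sg 2; sg 2], 1, false);
      ([::], 1, true)].

Lemma TE k : T k = T_with (nseq k.+1 (sgV 2)).
Proof. by []. Qed.

Lemma TstarE k : Tstar k = Tstar_with (nseq k.+1 (sgV 2)).
Proof.
by rewrite /Tstar TE /T_with /Tstar_with; move: k.+1 => m; rewrite /= !map_cat map_nseq.
Qed.

Lemma iter_fix (T : Type) m (f : T -> T) q : f q = q -> iter m f q = q.
Proof. by move=> fq; elim: m => //= m ->. Qed.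

Lemma qdiv_fix (Q : quandle) (x y : Q) : qop x y = x -> qdiv x y = x.
Proof. by move=> {1}<-; rewrite qopK. Qed.

(** * The relations for two colors that do not act on each other *)

Section Commuting.
Variables (Q : quandle) (x0 a b : Q).
Hypotheses (ab : qop a b = a) (ba : qop b a = b).

Let simpl_ab := (ab, ba, qop_idem, qdiv_fix ab, qdiv_fix ba, qdiv_fix (qop_idem a),
  qdiv_fix (qop_idem b)).

Let twist m p q r s : qop q r = q -> qop r q = r ->
  act (nseq m.*2 (sgV 2)) [:: p; q; r; s] = [:: p; q; r; s] :> seq Q.
Proof. by move=> qr rq; rewrite act_twist_l // iter_fix. Qed.

Lemma arc_rel_commuting_odd m :
  all (arc_rel x0 [:: a; a; b; b]) (T m.*2.+1) *
  all (arc_rel x0 [:: a; a; b; b]) (Tstar m.*2.+1).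
Proof.
rewrite TE TstarE -doubleS; have := @twist m.+1.
move: (nseq _ _) => u uE.
by rewrite /T_with /Tstar_with /arc_rel /= !act_cat /= /act_letter /= !(simpl_ab, uE) //= !eqxx.
Qed.

Lemma arc_rel_commuting_even m :
  (all (arc_rel x0 [:: a; a; b; b]) (T m.*2) = (a == b)) *
  (all (arc_rel x0 [:: a; a; b; b]) (Tstar m.*2) = (a == b)).
Proof.
(* The [2m + 1] crossings are [m] full twists and one extra crossing, which exchanges strands 2 and
   3 and so makes relations compare [a] with [b]. *)
rewrite TE TstarE -[m.*2.+1]add1n nseqD; have := @twist m.
move: (nseq _ _) => u uE.
rewrite /T_with /Tstar_with /arc_rel /= !act_cat /= /act_letter /= !(simpl_ab, uE) //=.
rewrite !(eqxx, simpl_ab).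
by rewrite /= !andbT !andbb.
Qed.

Lemma arc_rel_commuting_T0 : all (arc_rel x0 [:: a; a; b; b]) T0.
Proof. by rewrite /T0 /arc_rel /= /act_letter /= !simpl_ab !eqxx. Qed.

End Commuting.

(* [e] runs along the cycle of the color [e 1]; its predecessor [e 0] occurs because
   some of the crossings shift backwards. *)
Section Mixed.
Variables (Q : quandle) (x0 z : Q) (e : nat -> Q).
Hypotheses (ee : forall i j, qop (e i) (e j) = e i) (ez : forall i, qop (e i) z = e i.+1).
Hypotheses (ze : forall i, qop z (e i) = z).
Hypothesis (z_neq_e : forall i, (z == e i) = false).

Let ediv i : qdiv (e i.+1) z = e i. Proof. by rewrite -ez qopK. Qed.
Let simpl_ez := (ee, ez, ze, qop_idem, ediv, fun i j => qdiv_fix (ee i j),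
  fun i => qdiv_fix (ze i), qdiv_fix (qop_idem z)).

Let iter_e m i : iter m (fun x => qop x z) (e i) = e (m + i).
Proof. by elim: m => //= m ->. Qed.

Let twist_ze m p i s : act (nseq m.*2 (sgV 2)) [:: p; z; e i; s] = [:: p; z; e (m + i); s].
Proof. by rewrite act_twist_l // iter_e. Qed.

Let twist_ez m p i s : act (nseq m.*2 (sgV 2)) [:: p; e i; z; s] = [:: p; e (m + i); z; s].
Proof. by rewrite act_twist_r // iter_e. Qed.

Let twist_zz m p s : act (nseq m.*2 (sgV 2)) [:: p; z; z; s] = [:: p; z; z; s].
Proof. by rewrite act_twist_r ?iter_fix ?qop_idem. Qed.

Let twist_ee m p i j s :
  act (nseq m.*2 (sgV 2)) [:: p; e i; e j; s] = [:: p; e i; e j; s].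
Proof. by rewrite act_twist_r ?iter_fix. Qed.

(** The initial [sigma_2^2] moves one copy of [e 1] back to [e 0]. After [sigma_1] or [sigma_3] has
    exchanged the copies, the [m + 1] full twists carry the other one to [e m.+2]. *)
Lemma arc_rel_mixed_odd m :
  (all (arc_rel x0 [:: z; z; e 1; e 1]) (T m.*2.+1) = (e m.+2 == e 0)) *
  (all (arc_rel x0 [:: e 1; e 1; z; z]) (T m.*2.+1) = (e m.+2 == e 0)) *
  (all (arc_rel x0 [:: z; z; e 1; e 1]) (Tstar m.*2.+1) = (e m.+2 == e 0)) *
  (all (arc_rel x0 [:: e 1; e 1; z; z]) (Tstar m.*2.+1) = (e m.+2 == e 0)).
Proof.
rewrite TE TstarE -doubleS.
have := (@twist_ze m.+1, @twist_ez m.+1, @twist_zz m.+1, @twist_ee m.+1).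
move: (nseq _ _) => u uE; rewrite /T_with /Tstar_with /arc_rel /= !act_cat /= /act_letter /=.
rewrite !(simpl_ez, uE) /= !(eqxx, simpl_ez) !addSn !addn1 ?[e 0 == _]eq_sym.
by rewrite /= !andbT !andbb.
Qed.

(** The extra crossing leaves [z] next to some [e i] on the strands of a relation. *)
Lemma arc_rel_mixed_even m :
  (all (arc_rel x0 [:: z; z; e 1; e 1]) (T m.*2) = false) *
  (all (arc_rel x0 [:: e 1; e 1; z; z]) (T m.*2) = false) *
  (all (arc_rel x0 [:: z; z; e 1; e 1]) (Tstar m.*2) = false) *
  (all (arc_rel x0 [:: e 1; e 1; z; z]) (Tstar m.*2) = false).
Proof.
rewrite TE TstarE -[m.*2.+1]add1n nseqD.
have := (@twist_ze m, @twist_ez m, @twist_zz m, @twist_ee m).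
move: (nseq _ _) => u uE; rewrite /T_with /Tstar_with /arc_rel /= !act_cat /= /act_letter /=.
rewrite !(simpl_ez, uE) /= !(eqxx, simpl_ez).
by rewrite /= ![_ == z]eq_sym !z_neq_e.
Qed.

Lemma arc_rel_mixed_T0 : e 1 != e 0 ->
  (all (arc_rel x0 [:: z; z; e 1; e 1]) T0 = false) *
  (all (arc_rel x0 [:: e 1; e 1; z; z]) T0 = false).
Proof.
move=> ne; rewrite /T0 /arc_rel /= /act_letter /= !simpl_ez !eqxx.
(* Depending on the order of the two colors, the obstruction is [e 0 == e 1] or its translate by
   [z]. *)
have e12 : (e 1 == e 2) = (e 0 == e 1) by rewrite -(inj_eq (@qop_inj Q z) (e 0)) !ez.
by rewrite /= e12 [e 0 == _]eq_sym (negPf ne).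
Qed.

End Mixed.

(** * Counting the pairs of colors in [QN] *)

Section Counting.
Variable N : nat.
Hypothesis N_ge3 : 2 < N.
Variable x0 : QN N.
Implicit Types a b z : QN N.

Lemma commuting_star a b : star a = star b -> qop a b = a.
Proof.
by case: (boolP (star b)) => [_ sa|nb _]; [exact: star_op | exact: qop_nstar].
Qed.

Lemma iter_star_eq m z a : star z -> ~~ star a ->
  (iter m (fun x => qop x z) a == a) = (N - 1 %| m).
Proof.
move=> sz na; rewrite -val_eqE [val _](val_iter_star _ sz na) /=.
have lt_a : a < N - 1 by have := ltn_ord a; rewrite /star in na; lia.
by rewrite -{2}(modn_small lt_a) -{2}(addn0 a) eqn_modDl mod0n.
Qed.

Lemma arc_rel_QN_mixed a b : star a != star b ->
  [/\ all (arc_rel x0 [:: a; a; b; b]) T0 = false,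
      forall m, (all (arc_rel x0 [:: a; a; b; b]) (T m.*2) = false) *
                (all (arc_rel x0 [:: a; a; b; b]) (Tstar m.*2) = false)
    & forall m, (all (arc_rel x0 [:: a; a; b; b]) (T m.*2.+1) = (N - 1 %| m.+2)) *
                (all (arc_rel x0 [:: a; a; b; b]) (Tstar m.*2.+1) = (N - 1 %| m.+2))].
Proof.
have key z y : star z -> ~~ star y -> exists e : nat -> QN N,
    [/\ e 1 = y, forall i j, qop (e i) (e j) = e i, forall i, qop (e i) z = e i.+1,
        forall i, (qop z (e i) = z) * ((z == e i) = false)
      & forall i, (e i == e 0) = (N - 1 %| i)].
  (* The cycle starts one step before [y], so that [e 1] is [y]. *)
  move=> sz ny; exists (fun i => iter i (fun x => qop x z) (qdiv y z)).
  have ne i : star (iter i (fun x => qop x z) (qdiv y z)) = false.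
    by elim: i => [|i IH]; rewrite ?star_qop ?star_qdiv ?(negPf ny).
  split=> // [|i j|i|i]; first exact: qdivK.
  - by rewrite qop_nstar ?ne.
  - by rewrite star_op //; split=> //; apply/eqP=> E; have := ne i; rewrite -E sz.
  - by rewrite iter_star_eq // (ne 0).
case: (boolP (star a)) => sa; case: (boolP (star b)) => // sb _.
  have [e [<- ee ez ze e0]] := key a b sa sb.
  have ze1 i := (ze i).1; have ze2 i := (ze i).2.
  (* Since [N] is at least 3, [N - 1] does not divide 1, hence [e 1] differs from [e 0]. *)
  split=> [|m|m]; first by rewrite arc_rel_mixed_T0 // e0 dvdn1; lia.
    by rewrite !arc_rel_mixed_even.
  by rewrite !arc_rel_mixed_odd // e0.
have [e [<- ee ez ze e0]] := key b a sb sa.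
have ze1 i := (ze i).1; have ze2 i := (ze i).2.
split=> [|m|m]; first by rewrite arc_rel_mixed_T0 // e0 dvdn1; lia.
  by rewrite !arc_rel_mixed_even.
by rewrite !arc_rel_mixed_odd // e0.
Qed.

Lemma card_Col_chart (G : chart 4) R : arcs G = R ->
    ([::], 1) \in [seq r.1 | r <- R] -> ([::], 3) \in [seq r.1 | r <- R] ->
  #|Col (QN N) (F G)| =
  #|[set ab : QN N * QN N | all (arc_rel x0 [:: ab.1; ab.1; ab.2; ab.2]) R]|.
Proof. by move=> GR R1 R3; rewrite (card_Col _ x0) GR card_pairs. Qed.

Lemma card_Col_T0 (G : chart 4) : arcs G = T0 -> #|Col (QN N) (F G)| = (N - 1) ^ 2 + 1.
Proof.
move=> GT; rewrite (card_Col_chart GT) // -card_star_eq; last by lia.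
apply: eq_card => ab; rewrite !inE.
have [sab|sab] := eqVneq (star ab.1) (star ab.2); last by have [-> _ _] := arc_rel_QN_mixed sab.
by rewrite arc_rel_commuting_T0 ?commuting_star.
Qed.

Lemma card_Col_even m (G : chart 4) : arcs G = T m.*2 \/ arcs G = Tstar m.*2 ->
  #|Col (QN N) (F G)| = N.
Proof.
move=> GT; have -> : #|Col (QN N) (F G)| = #|[set ab : QN N * QN N | ab.1 == ab.2]|.
  case: GT => GT; rewrite (card_Col_chart GT) //; apply: eq_card => ab;
  rewrite !inE; (have [sab|sab] := eqVneq (star ab.1) (star ab.2);
    first by rewrite arc_rel_commuting_even ?commuting_star);
  have [_ -> _] := arc_rel_QN_mixed sab;
  by apply/esym; apply: contra_neqF sab => /eqP ->.
rewrite -[RHS](card_ord N) -cardsT -(card_imset _ (f := fun a : QN N => (a, a))).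
  apply: eq_card => -[a b]; rewrite inE /=; apply/eqP/imsetP => [->|[c _ [-> ->]] //].
  by exists b.
by move=> a b [].
Qed.

Lemma card_Col_odd m (G : chart 4) : arcs G = T m.*2.+1 \/ arcs G = Tstar m.*2.+1 ->
  #|Col (QN N) (F G)| = if N - 1 %| m.+2 then N ^ 2 else (N - 1) ^ 2 + 1.
Proof.
move=> GT; have -> : #|Col (QN N) (F G)| =
    #|[set ab : QN N * QN N | (star ab.1 == star ab.2) || (N - 1 %| m.+2)]|.
  case: GT => GT; rewrite (card_Col_chart GT) //; apply: eq_card => ab;
  rewrite !inE; (have [sab|sab] := eqVneq (star ab.1) (star ab.2);
    first by rewrite arc_rel_commuting_odd ?commuting_star);
  by have [_ _ ->] := arc_rel_QN_mixed sab.
case: (N - 1 %| m.+2).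
  have -> : N ^ 2 = #|[set: QN N * QN N]| by rewrite cardsT card_prod card_ord mulnn.
  by apply: eq_card => ab; rewrite !inE orbT.
rewrite -card_star_eq; last by lia.
by apply: eq_card => ab; rewrite !inE orbF.
Qed.

End Counting.

Theorem theorem3p2 (N k : nat) (hN : 3 <= N) (hk : 1 <= k) :
  [/\ (* (a) *)
      (forall G : chart 4, arcs G = T0 ->
         #|Col (QN N) (F G)| = (N - 1) ^ 2 + 1),
      (* (b) *)
      (forall G : chart 4, arcs G = T (2 * k) \/ arcs G = Tstar (2 * k) ->
         #|Col (QN N) (F G)| = N),
      (* (c) *)
      (forall G : chart 4, arcs G = T (2 * k - 1) \/ arcs G = Tstar (2 * k - 1) ->
         #|Col (QN (k + 2)) (F G)| = (k + 2) ^ 2)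
    & (* (d) *)
      (forall l : nat, 1 <= l < k ->
       forall G : chart 4, arcs G = T (2 * l - 1) \/ arcs G = Tstar (2 * l - 1) ->
         #|Col (QN (k + 2)) (F G)| = (k + 1) ^ 2 + 1)].
Proof.
(* The index [2m - 1] is [2(m - 1) + 1], so the shift to be compared with the cycle length is
   [m + 1]. *)
have oddE m : 0 < m -> 2 * m - 1 = m.-1.*2.+1 by lia.
have x0 M : 2 < M -> QN M by case: M => // M _; exact: (ord0 : 'I_M.+1).
have k2 : 2 < k + 2 by lia.
split=> [G|G|G|l /andP[l0 lk] G].
- by apply: card_Col_T0 => //; exact: x0.
- by rewrite mul2n; apply: card_Col_even => //; exact: x0.
- rewrite oddE // => /(card_Col_odd k2 (x0 _ k2)) ->.
  by rewrite (_ : k + 2 - 1 = k.-1.+2) ?dvdnn //; lia.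
rewrite oddE // => /(card_Col_odd k2 (x0 _ k2)) ->.
(* The shift [l + 1] is positive and smaller than the cycle length [k + 1]. *)
rewrite gtnNdvd //; last by lia.
by congr (_ ^ 2 + 1); lia.
Qed.
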